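(* Let $A$ be an idempotent semiring and let $\mathcal I$ be the set of all ideals of $A$, partially ordered by inclusion. For an ideal $I$ of $A$ let $$I^{int}:=\{x\in A\mid x^n+a_1x^{n-1}+\cdots+a_n=b_1x^{n-1}+\cdots+b_n\ \text{for some integer } n\ge 1 \text{ and some } a_i,b_i\in I^i\}.$$ Then $I^{int}$ is an ideal of $A$ for every ideal $I$ of $A$. Furthermore, the map $I\mapsto (I^{int})'$, where $(I^{int})'$ is the $k$-closure of the ideal $I^{int}$, defines a closure operation on $\mathcal I$.
   Context: A semiring is a nonempty set $A$ with operations $+,\cdot$ such that $(A,+)$ and $(A,\cdot)$ are commutative monoids (with identities $0$ and $1$), $(a+b)c=ac+bc$ and $0\cdot a=0$; it is idempotent if $a+a=a$ for all $a$. An ideal is an additive submonoid $I$ with $AI\subseteq I$; $I^i$ denotes the ideal consisting of finite sums of products of $i$ elements of $I$. A $k$-ideal is an ideal $I$ such that $x\in I$ and $x+y\in I$ imply $y\in I$. The $k$-closure $J'$ of an ideal $J$ is the intersection of all $k$-ideals of $A$ containing $J$. A closure operation on a poset $P$ is a map $\mathrm{cl}:P\to P$ with $x\le \mathrm{cl}(x)$, $\mathrm{cl}(\mathrm{cl}(x))=\mathrm{cl}(x)$, and $x\le y\Rightarrow \mathrm{cl}(x)\le\mathrm{cl}(y)$ for all $x,y\in P$. *)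

(* Defs.v *)
From HB Require Import structures.
From mathcomp Require Export all_boot all_order ssralg.
From mathcomp Require Export boolp classical_sets.

Set Implicit Arguments.
Unset Strict Implicit.
Unset Printing Implicit Defensive.

Export Order.TTheory GRing.Theory.

Local Open Scope classical_set_scope.
Local Open Scope ring_scope.

(* Semirings are MathComp's [comPzSemiRingType]: commutative, possibly zero. *)

Definition is_ideal (A : comPzSemiRingType) (I : set A) : Prop :=
  [/\ I 0,
      forall x y, I x -> I y -> I (x + y)
    & forall a x, I x -> I (a * x)].

Record ideal (A : comPzSemiRingType) := Ideal {
  ideal_set :> set A;
  idealP : is_ideal ideal_set
}.

Lemma ideal_inj (A : comPzSemiRingType) : injective (@ideal_set A).
Proof.
move=> [I hI] [J hJ] /= eIJ; rewrite eIJ in hI *.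
by congr Ideal; exact: Prop_irrelevance.
Qed.

HB.instance Definition _ (A : comPzSemiRingType) := gen_eqMixin (ideal A).
HB.instance Definition _ (A : comPzSemiRingType) := gen_choiceMixin (ideal A).

Definition le_ideal (A : comPzSemiRingType) (I J : ideal A) : bool :=
  `[< (I : set A) `<=` (J : set A) >].

Lemma le_ideal_refl (A : comPzSemiRingType) : reflexive (@le_ideal A).
Proof. by move=> I; apply/asboolP. Qed.

Lemma le_ideal_anti (A : comPzSemiRingType) : antisymmetric (@le_ideal A).
Proof.
move=> I J /andP[/asboolP IJ /asboolP JI].
by apply: ideal_inj; apply/seteqP; split.
Qed.

Lemma le_ideal_trans (A : comPzSemiRingType) : transitive (@le_ideal A).
Proof.
move=> J I K /asboolP IJ /asboolP JK.
by apply/asboolP; exact: subset_trans JK.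
Qed.

Fact ideal_display : Order.disp_t. Proof. by []. Qed.

HB.instance Definition _ (A : comPzSemiRingType) :=
  Order.Le_isPOrder.Build ideal_display (ideal A)
    (@le_ideal_refl A) (@le_ideal_anti A) (@le_ideal_trans A).

Lemma leidE (A : comPzSemiRingType) (I J : ideal A) :
  (I <= J)%O = ((I : set A) `<=` (J : set A)) :> Prop.
Proof. by rewrite -[LHS]/(is_true (le_ideal I J)) /le_ideal asboolE. Qed.

(* For i = 0 this is the set of sums of 1 rather than an ideal; only exponents
   i >= 1 are used below. *)
Definition ideal_exp (A : comPzSemiRingType) (I : ideal A) (i : nat) : set A :=
  [set x | exists (m : nat) (f : 'I_m -> 'I_i -> A),
      (forall j k, (I : set A) (f j k)) /\
      x = \sum_(j < m) \prod_(k < i) f j k].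

Lemma ideal_exp_is_ideal (A : comPzSemiRingType) (I : ideal A) (i : nat) :
  (0 < i)%N -> is_ideal (ideal_exp I i).
Proof.
case: i => // i _; have [I0 ID IM] := idealP I; split.
- by exists 0%N, (fun _ _ => 0); split=> //; rewrite big_ord0.
- move=> _ _ [m [f [fI ->]]] [n [g [gI ->]]].
  exists (m + n)%N, (fun j => match fintype.split j with
    | inl j1 => f j1 | inr j2 => g j2 end); split.
    by move=> j k; case: fintype.split.
  rewrite big_split_ord /=; congr (_ + _); apply: eq_bigr => j _.
    by rewrite (unsplitK (inl _ j)).
  by rewrite (unsplitK (inr _ j)).
- move=> a _ [m [f [fI ->]]].
  exists m, (fun j k => if k == ord0 then a * f j k else f j k); split.
    by move=> j k; case: eqP => _ //; exact: IM.
  rewrite big_distrr /=; apply: eq_bigr => j _.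
  by rewrite !big_ord_recl /= mulrA.
Qed.

Definition integral_set (A : comPzSemiRingType) (I : ideal A) : set A :=
  [set x | exists (n : nat) (a b : nat -> A),
      [/\ (1 <= n)%N,
          forall i, (1 <= i <= n)%N -> ideal_exp I i (a i) /\ ideal_exp I i (b i)
        & x ^+ n + \sum_(1 <= i < n.+1) a i * x ^+ (n - i)
          = \sum_(1 <= i < n.+1) b i * x ^+ (n - i)]].

Definition is_kideal (A : comPzSemiRingType) (I : ideal A) : Prop :=
  forall x y, (I : set A) x -> (I : set A) (x + y) -> (I : set A) y.

Definition kclosure_set (A : comPzSemiRingType) (J : ideal A) : set A :=
  [set x | forall K : ideal A, is_kideal K -> (J <= K)%O -> (K : set A) x].

Lemma kclosure_is_ideal (A : comPzSemiRingType) (J : ideal A) :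
  is_ideal (kclosure_set J).
Proof.
split.
- by move=> K _ _; have [] := idealP K.
- move=> x y hx hy K kK JK; have [_ KD _] := idealP K.
  by apply: KD; [exact: hx | exact: hy].
- by move=> a x hx K kK JK; have [_ _ KM] := idealP K; apply: KM; exact: hx.
Qed.

Definition kclosure (A : comPzSemiRingType) (J : ideal A) : ideal A :=
  Ideal (kclosure_is_ideal J).

Definition closure_operation (d : Order.disp_t) (P : porderType d)
    (cl : P -> P) : Prop :=
  [/\ forall x, (x <= cl x)%O,
      forall x, cl (cl x) = cl x
    & forall x y, (x <= y)%O -> (cl x <= cl y)%O].

(* Main.v *)
Require Import Defs.

(** An idempotent semiring is ordered by [x <= y :<-> x + y = y], and its
    k-ideals are exactly its downward closed ideals.  All the coefficients of an
    equation of integral dependence are dominated by the powers of one element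
    of the ideal, so [x] is integral over [I] iff [x ^ (n+1) <= y (x + y) ^ n]
    for some [y] in [I] and some [n].  In this form stability under sums is the
    binomial formula.  If moreover [y <= t] with [t] integral over [I], then
    [x + t] is integral over [I]; hence [x] lies in the downward closure of
    [I^int], which gives idempotence. *)

Set Implicit Arguments.
Unset Strict Implicit.
Unset Printing Implicit Defensive.

Local Open Scope classical_set_scope.
Local Open Scope ring_scope.

Definition addle (A : comPzSemiRingType) (x y : A) : Prop := x + y = y.

Local Notation "x <=+ y" := (addle x y) (at level 70, no associativity).

(** The degree of the equation is [n.+1], so the condition that it be positive is built in. *)
Definition integral_at (A : comPzSemiRingType) (y x : A) (n : nat) : Prop :=
  x ^+ n.+1 <=+ y * (x + y) ^+ n.

Section Idempotent.
Variables (A : comPzSemiRingType) (idemA : forall a : A, a + a = a).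
Implicit Types (x y z t w : A) (I J : ideal A).

(** * The order of an idempotent semiring *)

Lemma addle_refl x : x <=+ x.
Proof. exact: idemA. Qed.

Lemma addle_trans y x z : x <=+ y -> y <=+ z -> x <=+ z.
Proof. by rewrite /addle => xy yz; rewrite -yz addrA xy. Qed.

Lemma add0le x : 0 <=+ x.
Proof. exact: add0r. Qed.

Lemma addle_addr x y : x <=+ x + y.
Proof. by rewrite /addle addrA idemA. Qed.

Lemma addle_addl x y : x <=+ y + x.
Proof. by rewrite addrC; exact: addle_addr. Qed.

Lemma addle_join x y z : x <=+ z -> y <=+ z -> x + y <=+ z.
Proof. by rewrite /addle => xz yz; rewrite -addrA yz. Qed.

Lemma addle_add x y z t : x <=+ y -> z <=+ t -> x + z <=+ y + t.
Proof. by rewrite /addle => xy zt; rewrite addrACA xy zt. Qed.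

Lemma addle_mul x y z t : x <=+ y -> z <=+ t -> x * z <=+ y * t.
Proof.
move=> xy zt; apply: (@addle_trans (x * t)); rewrite /addle.
  by rewrite -mulrDr zt.
by rewrite -mulrDl xy.
Qed.

Lemma addle_exp x y n : x <=+ y -> x ^+ n <=+ y ^+ n.
Proof.
move=> xy; elim: n => [|n IHn]; first exact: addle_refl.
by rewrite !exprS; exact: addle_mul.
Qed.

Lemma addle_sum (T : Type) (r : seq T) (P : pred T) (F : T -> A) z :
  (forall i, P i -> F i <=+ z) -> \sum_(i <- r | P i) F i <=+ z.
Proof.
move=> Fz; apply: (big_ind (fun s => s <=+ z)) => //; first exact: add0le.
by move=> x y; exact: addle_join.
Qed.

Lemma addle_mulrn x z n : x <=+ z -> x *+ n <=+ z.
Proof.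
move=> xz; elim: n => [|n IHn]; first exact: add0le.
by rewrite mulrS; exact: addle_join.
Qed.

Lemma addle_sum_mem (n : nat) (F : 'I_n -> A) i : F i <=+ \sum_j F j.
Proof. by rewrite (bigD1 i) //=; exact: addle_addr. Qed.

(** * Powers of ideals and equations of integral dependence *)

Lemma ideal_sum I (T : Type) (r : seq T) (P : pred T) (F : T -> A) :
  (forall i, P i -> (I : set A) (F i)) -> (I : set A) (\sum_(i <- r | P i) F i).
Proof.
have [I0 ID _] := idealP I.
by move=> FI; apply: (big_ind (I : set A)).
Qed.

Lemma ideal_exp_le_expr I i c :
  ideal_exp I i c -> exists2 y, (I : set A) y & c <=+ y ^+ i.
Proof.
move=> [m [f [fI ->]]].
(* The sum of all factors of all terms dominates each factor, hence its [i]-th power dominates each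
   product. *)
exists (\sum_j \sum_k f j k).
  by apply: ideal_sum => j _; apply: ideal_sum => k _.
apply: addle_sum => j _; rewrite -[X in _ ^+ X]card_ord -prodr_const.
apply: (big_ind2 (fun u v => u <=+ v)) => [|u u' v v'|k _].
- exact: addle_refl.
- exact: addle_mul.
- apply: addle_trans (addle_sum_mem _ k) _.
  exact: (addle_sum_mem (fun j => \sum_k f j k)).
Qed.

(** The multiple [m] makes room for a binomial coefficient. *)
Lemma ideal_exp_expr_mulrn I y i m : (I : set A) y -> ideal_exp I i (y ^+ i *+ m).
Proof.
move=> Iy; exists m, (fun _ _ => y); split=> //.
by rewrite sumr_const prodr_const !card_ord.
Qed.

Lemma ideal_exp_common_bound I (b : nat -> A) n :
    (forall i, (1 <= i <= n)%N -> ideal_exp I i (b i)) ->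
  exists2 y, (I : set A) y & forall i, (1 <= i <= n)%N -> b i <=+ y ^+ i.
Proof.
have [I0 ID _] := idealP I.
elim: n => [|n IHn] bI; first by exists 0 => // i; case: i.
have [|y Iy bdy] := IHn.
  by move=> i /andP[i1 lein]; apply: bI; rewrite i1 leqW.
have [|z Iz bz] := @ideal_exp_le_expr I n.+1 (b n.+1).
  by apply: bI; rewrite leqnn.
exists (y + z) => [|i /andP[i1]]; first exact: ID.
rewrite leq_eqVlt ltnS => /predU1P[->|lein].
  by apply: addle_trans bz _; apply: addle_exp; exact: addle_addl.
apply: addle_trans (bdy i _) _; first by rewrite i1.
by apply: addle_exp; exact: addle_addr.
Qed.

Lemma integral_setP I x :
  integral_set I x <-> exists y n, (I : set A) y /\ integral_at y x n.
Proof.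
split=> [[[|n] [a [b [// _ abI eqx]]]]|[y [n [Iy ix]]]].
  have [|y Iy bound] := @ideal_exp_common_bound I b n.+1.
    by move=> i /abI[].
  exists y, n; split=> //.
  apply: (@addle_trans (\sum_(1 <= i < n.+2) b i * x ^+ (n.+1 - i))).
    by rewrite -eqx; exact: addle_addr.
  rewrite big_nat_cond; apply: addle_sum => -[|i]; rewrite andbT //= ltnS => lein.
  (* The term of index [i.+1] is at most [y ^+ i.+1 * x ^+ (n - i)]; one factor [y] is set aside and
     the other [n] factors are each below [x + y]. *)
  apply: addle_trans (addle_mul (bound i.+1 lein) (addle_refl _)) _.
  rewrite subSS exprS -mulrA; apply: addle_mul; first exact: addle_refl.
  rewrite -[X in _ <=+ _ ^+ X](@subnKC i n) // exprD.
  by apply: addle_mul; apply: addle_exp; [exact: addle_addl|exact: addle_addr].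
(* These are the coefficients in the expansion of [y * (x + y) ^+ n]. Taking them on both sides
   turns the equation into the inequality [integral_at y x n]. *)
pose b i := y ^+ i *+ 'C(n, i.-1).
exists n.+1, b, b; split=> // [i _|].
  by split; exact: ideal_exp_expr_mulrn.
have -> : \sum_(1 <= i < n.+2) b i * x ^+ (n.+1 - i) = y * (x + y) ^+ n.
  rewrite big_add1 big_mkord exprDn mulr_sumr; apply: eq_bigr => i _.
  by rewrite /b /= subSS mulrnAl mulrnAr exprS -mulrA [_ ^+ i * _]mulrC.
exact: ix.
Qed.

(** * Integral elements form an ideal *)

Lemma integral_at_mono y t x n : y <=+ t -> integral_at y x n -> integral_at t x n.
Proof.
move=> yt ix; apply: addle_trans ix _; apply: addle_mul => //.
by apply: addle_exp; apply: addle_add => //; exact: addle_refl.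
Qed.

Lemma integral_at_mulr_exp y x n m z :
    integral_at y x n -> x + y <=+ z -> (n < m)%N ->
  x ^+ m <=+ y * z ^+ m.-1.
Proof.
move=> ix xyz ltnm; rewrite -(subnKC ltnm) exprD addSn /= exprD mulrA.
apply: addle_mul.
  apply: addle_trans ix _; apply: addle_mul; first exact: addle_refl.
  exact: addle_exp.
by apply: addle_exp; apply: addle_trans xyz; exact: addle_addr.
Qed.

(** In each binomial term of degree [n1 + n2 + 1], either [x2] has exponent above [n2] or [x1] has
    exponent above [n1]. That power yields a factor [y], and everything else is bounded by powers of
    [z]. *)
Lemma integral_atD y x1 x2 n1 n2 :
    integral_at y x1 n1 -> integral_at y x2 n2 ->
  integral_at y (x1 + x2) (n1 + n2).
Proof.
move=> ix1 ix2; rewrite /integral_at exprDn; set z := _ + y.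
have x1z : x1 + y <=+ z.
  by apply: addle_add; [exact: addle_addr|exact: addle_refl].
have x2z : x2 + y <=+ z.
  by apply: addle_add; [exact: addle_addl|exact: addle_refl].
apply: addle_sum => -[i /=]; rewrite ltnS => lei _; apply: addle_mulrn.
have [lt2i|lei2] := ltnP n2 i.
  have eN : (n1 + n2 = (n1 + n2).+1 - i + i.-1)%N.
    by case: i lt2i lei => // k _ lek; rewrite subSS subnK.
  rewrite [X in y * z ^+ X]eN [z ^+ _]exprD mulrCA; apply: addle_mul.
    by apply: addle_exp; apply: addle_trans x1z; exact: addle_addr.
  exact: integral_at_mulr_exp ix2 _ lt2i.
have le2 : (i <= n1 + n2)%N by rewrite (leq_trans lei2) ?leq_addl.
rewrite -[X in _ <=+ _ * _ ^+ X](subnK le2) exprD mulrA; apply: addle_mul.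
  rewrite subSn //; apply: (integral_at_mulr_exp ix1 x1z).
  by rewrite ltnS -addnBA // leq_addr.
by apply: addle_exp; apply: addle_trans x2z; exact: addle_addr.
Qed.

Lemma integral_atM a y x n : integral_at y x n -> integral_at (a * y) (a * x) n.
Proof.
rewrite /integral_at -mulrDr !exprMn mulrACA -exprS.
by move=> ix; apply: addle_mul => //; exact: addle_refl.
Qed.

Lemma integral_set_is_ideal I : is_ideal (integral_set I).
Proof.
have [I0 ID IM] := idealP I; split.
- apply/integral_setP; exists 0, 0%N; split=> //.
  by rewrite /integral_at expr1; exact: add0le.
- move=> x1 x2 /integral_setP[y1 [n1 [Iy1 ix1]]].
  move=> /integral_setP[y2 [n2 [Iy2 ix2]]].
  apply/integral_setP; exists (y1 + y2), (n1 + n2)%N; split; first exact: ID.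
  apply: integral_atD.
    by apply: integral_at_mono ix1; exact: addle_addr.
  by apply: integral_at_mono ix2; exact: addle_addl.
- move=> a x /integral_setP[y [n [Iy ix]]].
  apply/integral_setP; exists (a * y), n; split; first exact: IM.
  exact: integral_atM.
Qed.

(** * Extension, monotonicity and transitivity of integral dependence *)

Lemma sub_integral_set I : (I : set A) `<=` integral_set I.
Proof.
move=> x Ix; apply/integral_setP; exists x, 0%N; split=> //.
by rewrite /integral_at expr0 expr1 mulr1; exact: addle_refl.
Qed.

Lemma integral_set_mono I J :
  (I : set A) `<=` (J : set A) -> integral_set I `<=` integral_set J.
Proof.
move=> IJ x /integral_setP[y [n [Iy ix]]].
by apply/integral_setP; exists y, n; split=> //; exact: IJ.
Qed.

Lemma integral_at_trans w t y x m n :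
    integral_at y x n -> y <=+ t -> integral_at w t m ->
  integral_at w (x + t) (m + n).
Proof.
move=> ix yt it; set z := x + t.
have tz : t <=+ z by exact: addle_addl.
(* In the expansion of [z ^+ n.+1], the pure power of [x] is handled by its integrality over [t];
   every other term already contains a factor [t]. *)
have zS : z ^+ n.+1 <=+ t * z ^+ n.
  rewrite {1}/z exprDn; apply: addle_sum => i _; apply: addle_mulrn.
  case: (nat_of_ord i) (ltn_ord i) => [_|k].
    by rewrite subn0 expr0 mulr1; exact: integral_at_mono ix.
  rewrite !ltnS subSS => lekn; rewrite mulrC exprS -mulrA.
  apply: addle_mul; first exact: addle_refl.
  rewrite -[X in _ <=+ _ ^+ X](subnKC lekn) exprD.
  by apply: addle_mul; apply: addle_exp => //; exact: addle_addr.
(* Iterating [zS] trades [k] factors [z] for factors [t]; at [k = m.+1] the integrality of [t] over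
   [w] applies. *)
have zD k : z ^+ (k + n) <=+ t ^+ k * z ^+ n.
  elim: k => [|k IHk]; first by rewrite expr0 mul1r; exact: addle_refl.
  rewrite addSn exprS.
  apply: addle_trans (addle_mul (addle_refl z) IHk) _.
  rewrite mulrCA -exprS [t ^+ _.+1]exprSr -mulrA.
  by apply: addle_mul => //; exact: addle_refl.
rewrite /integral_at -addSn; apply: addle_trans (zD m.+1) _.
rewrite exprD mulrA; apply: addle_mul; last first.
  by apply: addle_exp; exact: addle_addr.
apply: addle_trans it _; apply: addle_mul; first exact: addle_refl.
by apply: addle_exp; apply: addle_add => //; exact: addle_refl.
Qed.

(** * The k-closure as downward closure *)

Lemma kideal_addle I x y :
  is_kideal I -> x <=+ y -> (I : set A) y -> (I : set A) x.
Proof. by move=> kI xy Iy; apply: (kI y) => //; rewrite addrC xy. Qed.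

Lemma downset_is_ideal I : is_ideal [set x | exists2 y, (I : set A) y & x <=+ y].
Proof.
have [I0 ID IM] := idealP I; split.
- by exists 0 => //; exact: addle_refl.
- move=> x1 x2 [y1 Iy1 xy1] [y2 Iy2 xy2].
  by exists (y1 + y2); [exact: ID|exact: addle_add].
- move=> a x [y Iy xy]; exists (a * y); first exact: IM.
  by apply: addle_mul => //; exact: addle_refl.
Qed.

Lemma kclosureP I x :
  (kclosure I : set A) x <-> exists2 y, (I : set A) y & x <=+ y.
Proof.
split=> [clx|[y Iy xy] K kK]; last first.
  by rewrite leidE => IK; apply: kideal_addle kK xy _; exact: IK.
apply: (clx (Ideal (downset_is_ideal I))).
  (* The downward closure is a k-ideal because [v] lies below [u + v]. *)
  move=> u v _ [y Iy uvy]; exists y => //.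
  by apply: addle_trans uvy; exact: addle_addl.
by rewrite leidE => y Iy; exists y => //; exact: addle_refl.
Qed.

End Idempotent.

Theorem theoremD (A : comPzSemiRingType) (idemA : forall a : A, a + a = a) :
  exists intP : forall I : ideal A, is_ideal (integral_set I),
    closure_operation (fun I : ideal A => kclosure (Ideal (intP I))).
Proof.
exists (integral_set_is_ideal idemA).
have ext (I : ideal A) :
    (I <= kclosure (Ideal (integral_set_is_ideal idemA I)))%O.
  rewrite leidE => x Ix; apply/(kclosureP idemA); exists x.
    exact: (sub_integral_set idemA).
  exact: (addle_refl idemA).
split=> // [I|I J].
  apply/eqP; rewrite eq_le ext andbT leidE => x.
  move=> /(kclosureP idemA)[u /(integral_setP idemA)[y [n [Ky iu]]] xu].
  have [t /(integral_setP idemA)[w [m [Iw it]]] yt] := (kclosureP idemA _ _).1 Ky.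
  (* Transitivity gives integrality over [I] for [u + t], not for [u]; this is enough since [x] lies
     below [u], hence below [u + t]. *)
  apply/(kclosureP idemA); exists (u + t); last first.
    by apply: addle_trans xu _; exact: (addle_addr idemA).
  apply/(integral_setP idemA); exists w, (m + n)%N; split=> //.
  exact: (integral_at_trans idemA iu yt it).
rewrite !leidE => IJ x /(kclosureP idemA)[y Iy xy].
apply/(kclosureP idemA); exists y => //.
exact: (integral_set_mono idemA IJ).
Qed.
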